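(* Let $n\ge 2$ and let $U_n$ be the set of linearly ordered factorizations of the $n$-cycle $(1,2,\dots,n)$, where each $u\in U_n$ is given the descent set $\mathrm{Des}(\phi(u))\subseteq\{1,\dots,n-2\}$. Then $$\mathcal{Q}(U_n):=\sum_{u\in U_n}\mathcal{F}_{n-1,\mathrm{Des}(\phi(u))}=\sum_{k=0}^{n-2}(k+1)\,s_{(n-1-k,1^k)}.$$ In particular, $U_n$ is Schur-positive, i.e. $\mathcal{Q}(U_n)$ is a symmetric function all of whose coefficients in the basis of Schur functions are nonnegative.
   Context: Notation: $[m]=\{1,\dots,m\}$; products of permutations are composed from right to left. A factorization of the $n$-cycle $(1,2,\dots,n)$ (i.e. $1\mapsto 2\mapsto\cdots\mapsto n\mapsto 1$) is a sequence $w=(t_1,\dots,t_{n-1})$ of transpositions in $\mathfrak{S}_n$ with $t_1\cdots t_{n-1}=(1,2,\dots,n)$; $F_n$ is the set of all of these. A factorization is linearly ordered if for every $1\le i\le n-2$, $t_i$ and $t_{i+1}$ have a common letter; $U_n\subseteq F_n$ is the set of linearly ordered factorizations. The map $\phi:F_n\to\mathfrak{S}_{n-1}$ (Adin–Roichman edge labeling): for $w=(t_1,\dots,t_{n-1})\in F_n$ put $\sigma_j=t_jt_{j+1}\cdots t_{n-1}$ for $1\le j\le n-1$ and $\sigma_n=\mathrm{id}$. For $1\le j\le n-1$ let $A_j=\{\,1\le i\le n-1:\sigma_j(i)>\sigma_{j+1}(i)\,\}$. It is known that each $A_j$ has exactly one element and that $\phi(w)$, defined by letting $\phi(w)(j)$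 be the unique element of $A_j$, is a permutation in $\mathfrak{S}_{n-1}$. For $\pi\in\mathfrak{S}_{n-1}$, $\mathrm{Des}(\pi)=\{i\in[n-2]:\pi(i)>\pi(i+1)\}$. For $D\subseteq[m-1]$, Gessel's fundamental quasi-symmetric function is $$\mathcal{F}_{m,D}(\mathbf{x})=\sum_{\substack{i_1\le i_2\le\cdots\le i_m\\ i_j<i_{j+1}\text{ if }j\in D}}x_{i_1}x_{i_2}\cdots x_{i_m}.$$ $s_\lambda$ denotes the Schur function of the partition $\lambda$, and $(a,1^k)$ is the hook partition with first part $a$ followed by $k$ parts equal to $1$. *)

(* Defs.v *)
From HB Require Import structures.
From mathcomp Require Import all_boot all_order all_algebra all_fingroup.
From mathcomp Require Import finmap multiset.

Set Implicit Arguments.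
Unset Strict Implicit.
Unset Printing Implicit Defensive.

Import GRing.Theory.

(* The letters 1, ..., n are the elements 0, ..., n - 1 of 'I_n; positions in
   words and variables of power series are likewise numbered from 0. *)

(** * Factorizations of the n-cycle *)

Section Factorizations.
Local Open Scope group_scope.
Variable n : nat.
Implicit Types (w : n.-1.-tuple 'S_n) (s t : 'S_n).

(* [s * t] is "s first, then t" in MathComp, whence the reversal in the
   right-to-left product t_1 t_2 ... t_k of the sequence [:: t_1; ...; t_k]. *)
Definition rlprod (ts : seq 'S_n) : 'S_n := \prod_(t <- rev ts) t.

(* i |-> i + 1 mod n *)
Definition long_cycle : 'S_n := perm (@ordS_inj n).

Definition is_transposition t : bool :=
  [exists a, exists b, (a != b) && (t == tperm a b)].

Definition factorizations : {set n.-1.-tuple 'S_n} :=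
  [set w : n.-1.-tuple 'S_n | all is_transposition w & rlprod w == long_cycle].

(* The letters of a transposition are the points that it moves. *)
Definition common_letter s t : bool := [exists a, (s a != a) && (t a != a)].

Definition linearly_ordered : {set n.-1.-tuple 'S_n} :=
  [set w in factorizations | sorted common_letter w].

(** * The Adin-Roichman edge labeling *)

(* sigma_{j+1} = t_{j+1} ... t_{n-1}; in particular [sigma w n.-1 = 1]. *)
Definition sigma w (j : nat) : 'S_n := rlprod (drop j w).

Definition ascents w (j : 'I_n.-1) : {set 'I_n.-1} :=
  [set i : 'I_n.-1 | sigma w j.+1 (widen_ord (leq_pred n) i)
                     < sigma w j (widen_ord (leq_pred n) i)].

(* The default value 1 is never used on factorizations: see [phiP]. *)
Definition phi w : 'S_n.-1 :=
  odflt 1 [pick p : 'S_n.-1 | [forall j, ascents w j == [set p j]]].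

Lemma sigmaS w (j : 'I_n.-1) : sigma w j = sigma w j.+1 * tnth w j.
Proof.
rewrite /sigma /rlprod (drop_nth 1) ?size_tuple // rev_cons big_rcons /=.
by rewrite (tnth_nth 1).
Qed.

Lemma transposition_ascent t (a b : 'I_n) :
  is_transposition t -> a < t a -> b < t b -> a = b.
Proof.
case/existsP=> x /existsP[y /andP[_ /eqP->]].
do 2![case: tpermP => [->|->|_ _]] => //; rewrite ?ltnn // => lt1 lt2.
all: by have:= ltn_trans lt1 lt2; rewrite ltnn.
Qed.

Lemma phiP w :
  w \in factorizations -> forall j, ascents w j = [set phi w j].
Proof.
rewrite inE => /andP[/allP tw /eqP cw].
have asc1 j i i' : i \in ascents w j -> i' \in ascents w j -> i = i'.
  have tj : is_transposition (tnth w j) by apply/tw/mem_tnth.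
  rewrite !inE sigmaS !permM => /(transposition_ascent tj)h /h.
  by move/perm_inj=> eq_i; apply: val_inj; have:= congr1 val eq_i.
have /fin_all_exists[f fP] (i : 'I_n.-1) : exists j, i \in ascents w j.
  apply/existsP; apply: contraT; rewrite negb_exists => /forallP noasc.
  set i' := widen_ord (leq_pred n) i.
  have: forall k, k <= n.-1 -> sigma w 0 i' <= sigma w k i'.
    elim=> // k IHk lt_kn; apply: leq_trans (IHk (ltnW lt_kn)) _.
    by have:= noasc (Ordinal lt_kn); rewrite inE -leqNgt.
  move/(_ _ (leqnn _)); rewrite /sigma drop0 cw drop_oversize ?size_tuple //.
  rewrite /rlprod big_nil perm1 permE /= modn_small ?ltnn //.
  by rewrite -ltn_predRL.
have f_inj : injective f by move=> i i' eq_f; apply: asc1 (fP i) _; rewrite eq_f.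
have pP j : ascents w j = [set (perm f_inj)^-1 j].
  have jP : (perm f_inj)^-1 j \in ascents w j.
    by have:= fP ((perm f_inj)^-1 j); rewrite -(permE f_inj) permKV.
  apply/setP=> i; rewrite [RHS]inE; apply/idP/eqP => [iP|->//].
  exact: asc1 iP jP.
rewrite /phi; case: pickP => [p /forallP pW j|/(_ (perm f_inj)^-1)].
  exact/eqP.
by case/negP; apply/forallP=> j; apply/eqP.
Qed.

End Factorizations.

Section Descents.
Variable m : nat.

Definition ord_left (i : 'I_m.-1) : 'I_m := widen_ord (leq_pred m) i.
Definition ord_right (i : 'I_m.-1) : 'I_m :=
  Ordinal (etrans (esym (ltn_predRL i m)) (ltn_ord i)).

Definition Des (p : 'S_m) : {set 'I_m.-1} :=
  [set i : 'I_m.-1 | p (ord_right i) < p (ord_left i)].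

End Descents.

(** * Formal power series in the variables x_0, x_1, x_2, ... *)

(* A monomial is the multiset of its variables; a series is its family of
   coefficients. *)
Definition fseries := {mset nat}%mset -> int.

(* The sum of the x_{i_1} ... x_{i_m} over all words [:: i_1; ...; i_m]
   satisfying P: [permutations M] lists, without repetition, all the words
   whose multiset of letters is M. *)
Definition word_series (P : pred (seq nat)) : fseries :=
  fun M => Posz (count P (permutations M)).

Definition fundamental (m : nat) (D : {set 'I_m.-1}) : fseries :=
  word_series (fun w =>
    [&& size w == m, sorted leq w
      & [forall i : 'I_m.-1, (i \in D) ==> (nth 0 w i < nth 0 w i.+1)]]).

(** * Schur functions *)

Definition is_partition (lam : seq nat) : bool :=
  sorted geq lam && (0 \notin lam).

(* A tableau is the sequence of its rows. *)
Definition semistandard (T : seq (seq nat)) : bool :=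
  all (sorted leq) T &&
  [forall i : 'I_(size T), forall j : 'I_(size (nth [::] T i.+1)),
     nth 0 (nth [::] T i) j < nth 0 (nth [::] T i.+1) j].

(* A filling of the shape lam is encoded by the concatenation of its rows. *)
Definition schur (lam : seq nat) : fseries :=
  word_series (fun w =>
    (size w == sumn lam) && semistandard (reshape lam w)).

Definition hook (a k : nat) : seq nat := a :: nseq k 1.

Definition symmetric_function (f : fseries) : Prop :=
  (exists d : nat, forall M : {mset nat}%mset, f M != 0%R -> size M <= d) /\
  (forall g : nat -> nat, bijective g ->
     forall M : {mset nat}%mset, f (seq_mset (map g M)) = f M).

Definition schur_positive (f : fseries) : Prop :=
  symmetric_function f /\
  exists (parts : seq (seq nat)) (c : seq nat -> int),
    [/\ uniq parts, all is_partition parts,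
        forall lam, lam \in parts -> (0 <= c lam)%R
      & forall M, f M = (\sum_(lam <- parts) c lam * schur lam M)%R].

Definition Qsym (n : nat) (A : {set n.-1.-tuple 'S_n}) : fseries :=
  fun M => (\sum_(w in A) fundamental (Des (phi w)) M)%R.

(* Main.v *)
Require Import Defs.
From mathcomp Require Import all_boot all_order all_algebra all_fingroup.
From mathcomp Require Import finmap multiset.
From mathcomp Require Import zify.

(** Linear order makes the factors t_j, ..., t_{n-1} into a connected tree with
    at most n - j + 1 letters.  By induction on j, sigma_j is the increasing
    cycle on a set B_j of n - j + 1 letters: if that holds for j, then the
    shorter product sigma_{j+1} = t_j sigma_j touches at most n - j letters, so
    it fixes some b in B_j, which forces t_j = (b, sigma_j(b)), and
    sigma_{j+1} is sigma_j with b cut out ([cycle_word_cons]).  Hence a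
    factorization is determined by the ranks of the successively deleted
    letters, and t_j, t_{j+1} have a common letter exactly when the second
    deleted letter was a cyclic neighbour of the first
    ([common_letter_edges]).  This identifies the linearly ordered
    factorizations with the rank sequences in [codes]
    ([cycle_words_peel], [peel_inj]).

    The label phi(w)(j) is the deleted letter b, except that it is the second
    largest letter of B_j when b is the largest; in terms of ranks it has index
    min(k, |B_j| - 2).  So the descent set is read off the ranks alone
    ([desc_word]), with no reference to permutations ([Des_phi_peel]).

    A code has one prolongation by a new first rank without a descent, and one
    with a descent, or two if the old first rank was 0 or maximal.  For each
    descent word there is exactly one code whose first rank is 0 or maximal
    ([count_codes_extreme_head]), so each new descent adds one to the number of
    codes: a set D is the descent set of |D| + 1 linearly ordered
    factorizations ([card_linearly_ordered_Des]).

    It remains to see that the Schur function of the hook (m - k, 1^k) is the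
    sum of the fundamental functions of all D with k elements
    ([schur_hook_fundamental]).  The coefficient of a monomial with m letters,
    d of them distinct, is the binomial coefficient of d - 1 and k on both
    sides: D must be chosen among the d - 1 strict ascents of the sorted
    word, and the column of a hook tableau, below its corner, among the d - 1
    letters other than the least.  The same formula shows that these Schur
    functions are symmetric. *)

Set Implicit Arguments.
Unset Strict Implicit.
Unset Printing Implicit Defensive.

(** * Cyclic successors and deletions in lists *)

Definition cyc_succ m k := if k.+1 < m then k.+1 else 0.

Lemma cyc_succ_lt m i : 0 < m -> cyc_succ m i < m.
Proof. by rewrite /cyc_succ; case: ifP. Qed.

Lemma bumpE h i : bump h i = if h <= i then i.+1 else i.
Proof. by rewrite /bump; case: leqP. Qed.

Lemma unbumpE h i : unbump h i = if h < i then i.-1 else i.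
Proof. by rewrite /unbump; case: ltnP; rewrite ?subn1 ?subn0. Qed.

Section Delete.
Variable (T : eqType) (x0 : T).
Implicit Types l : seq T.
Definition delete k l := take k l ++ drop k.+1 l.

Lemma size_delete k l : k < size l -> size (delete k l) = (size l).-1.
Proof. by move=> kl; rewrite size_cat size_take kl size_drop; lia. Qed.

Lemma nth_delete k l i : k < size l ->
  nth x0 (delete k l) i = nth x0 l (bump k i).
Proof.
move=> kl; rewrite nth_cat size_take kl /bump; case: ltnP => ik.
  by rewrite nth_take.
by rewrite nth_drop /=; congr nth; lia.
Qed.

Lemma delete_subseq k l : subseq (delete k l) l.
Proof.
rewrite -[X in subseq _ X](cat_take_drop k l) cat_subseq //.
by rewrite -[k.+1]add1n -drop_drop drop_subseq.
Qed.

Lemma nth_notin_delete k l : uniq l -> k < size l -> nth x0 l k \notin delete k l.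
Proof.
move=> ul kl; apply/(nthP x0) => -[i]; rewrite size_delete // nth_delete // =>
  il /eqP.
by rewrite nth_uniq // /bump; lia.
Qed.

Lemma next_nth_cyc_succ l i :
  uniq l -> i < size l -> next l (nth x0 l i) = nth x0 l (cyc_succ (size l) i).
Proof.
move=> ul il; rewrite next_nth mem_nth // /cyc_succ.
case: l ul il => // y l ul il; rewrite index_uniq //= ltnS.
by case: ltnP => [?|?]; [apply: set_nth_default | rewrite nth_default].
Qed.
End Delete.

Lemma cyc_succ_inj m i j : i < m -> j < m -> cyc_succ m i = cyc_succ m j -> i = j.
Proof. by rewrite /cyc_succ; do 2![case: ifP]; lia. Qed.

Lemma unbump_lt m k i : i < m -> k < m -> i != k ->
  bump k (unbump k i) = i /\ unbump k i < m.-1.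
Proof.
by move=> im km ik; rewrite unbumpK //; split=> //; rewrite unbumpE; case: ifP;
  lia.
Qed.

(** Cutting the entry of index k out of a cycle sends the predecessor of that
    entry to its successor and leaves the other arrows alone; [bump k] turns an
    index in the shortened list into an index in the original one. *)
Lemma cyc_succ_bump m k i : k < m -> i < m.-1 ->
  bump k (cyc_succ m.-1 i) =
  if cyc_succ m (bump k i) == k then cyc_succ m k else cyc_succ m (bump k i).
Proof. by rewrite /cyc_succ !bumpE; repeat case: ifP; lia. Qed.

(** * Codes and their descent words *)

(** The index of a cyclic neighbour of entry k, in the list of r + 3 entries from
    which entry k has been removed: the successor of k moves to index k, or 0 if k
    was the last index, and the predecessor is the entry cyclically before that
    one. *)
Definition cyc_adjacent r k v :=
  let k' := if k < r.+2 then k else 0 in (k' == v) || (k' == cyc_succ r.+2 v).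

Definition preceding_ranks r v := [seq k <- iota 0 r.+3 | cyc_adjacent r k v].

(** A code of level r lists the ranks of the letters deleted one after the other
    from a set of r + 2 letters, until one is left.  Either letter of a
    two-element set may be deleted, with the same transposition, so the last rank
    is set to 0. *)
Fixpoint codes r : seq (seq nat) :=
  if r is r'.+1 then
    [seq k :: c | c <- codes r', k <- preceding_ranks r' (head 0 c)]
  else [:: [:: 0]].

(** Rank k at level r carries the letter of index min(k, r), as the largest letter
    is never a label.  The index of the next label is taken in the shortened list. *)
Fixpoint desc_word r (c : seq nat) : seq bool :=
  if c is k :: c' then
    if r is r'.+1 then
      (minn (head 0 c') r' < minn k r) :: desc_word r' c'
    else [::]
  else [::].

Lemma codesS r k c :
  (k :: c \in codes r.+1) =
  [&& c \in codes r, k < r.+3 & cyc_adjacent r k (head 0 c)].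
Proof.
apply/allpairsPdep/and3P => [[c' [k' []]]|[cr kr ad]].
  rewrite mem_filter mem_iota /= add0n => cr /andP[ad kr] [-> ->].
  by split.
by exists c, k; rewrite mem_filter mem_iota ad.
Qed.

Lemma codes_cons r c :
  c \in codes r -> exists k c', c = k :: c' /\ k < r.+2.
Proof.
case: r => [|r]; first by rewrite inE => /eqP->; exists 0, [::].
case: c => [|k c]; last by rewrite codesS => /and3P[_ kr _]; exists k, c.
by case/allpairsPdep=> [? [? []]].
Qed.

Lemma codes_uniq r : uniq (codes r).
Proof.
elim: r => [|r IHr] //=; apply: allpairs_uniq_dep => //.
  by move=> c _; rewrite filter_uniq ?iota_uniq.
by move=> [c k] [c' k'] _ _ /= [-> ->].
Qed.

Definition extreme_head r (c : seq nat) := (head 0 c == 0) || (head 0 c == r.+1).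

Lemma count_codesS r (P : pred (seq nat)) :
  count P (codes r.+1) =
  \sum_(c <- codes r)
     count (fun k => P (k :: c) && cyc_adjacent r k (head 0 c)) (iota 0 r.+3).
Proof.
rewrite [codes _]/= /allpairs_dep count_flatten sumnE !big_map;
  apply: eq_bigr => c _.
by rewrite count_map count_filter; apply: eq_count.
Qed.

Lemma count_iota_pred1 m k : k < m -> count (pred1 k) (iota 0 m) = 1.
Proof. by move=> km; rewrite count_uniq_mem ?iota_uniq // mem_iota /= km. Qed.

(** The prolongations with first rank 0 or r + 2 exist exactly when the old first
    rank is extreme: then 0 creates no descent and r + 2 creates one.  So each
    letter of the descent word determines the first rank, and the count is
    inherited from level r. *)
Lemma count_codes_extreme_head r d :
  size d = r ->
  count (fun c => (desc_word r c == d) && extreme_head r c) (codes r) = 1.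
Proof.
elim: r d => [|r IHr] [|b d] //= [sz]; rewrite count_codesS.
rewrite -[RHS](IHr d sz) -sum1_count [RHS]big_mkcond [LHS]big_seq [RHS]big_seq /=.
apply: eq_bigr => c /codes_cons[v [c' [-> vr]]].
rewrite {1}/extreme_head /=.
rewrite -[LHS]/(count _ (iota 0 r.+3)).
rewrite (eq_in_count (a2 := fun k => [&& desc_word r (v :: c') == d,
  extreme_head r (v :: c') & k == if b then r.+2 else 0])); last first.
  move=> k; rewrite mem_iota /= add0n => kr.
  rewrite eqseq_cons /extreme_head /cyc_adjacent /cyc_succ /=.
  by case: (desc_word _ _ == d); case: b; rewrite ?andbF ?andbT ?eqb_id
    ?eqbF_neg //=; repeat case: ifP => ?; lia.
case: (_ == d); rewrite ?count_pred0 //=.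
case: (extreme_head _ _); rewrite ?count_pred0 //=.
by apply: (@count_iota_pred1 r.+3 (if b then r.+2 else 0)); case: (b).
Qed.

(** Besides the neighbours v (no descent) and v + 1 (descent) of a middle rank, an
    extreme v also has the other end of the longer list as a neighbour.  When
    v = 0 the candidates are 0, 1, r + 2, and when v = r + 1 they are 0, r + 1,
    r + 2: in both cases only 0 avoids a descent. *)
Lemma count_preceding_ranks r v b : v < r.+2 ->
  count (fun k => ((minn v r < minn k r.+1) == b) && cyc_adjacent r k v)
    (iota 0 r.+3)
  = 1 + b * ((v == 0) || (v == r.+1)).
Proof.
move=> vr; case: b; last first.
  rewrite mul0n addn0.
  rewrite -(@count_iota_pred1 r.+3 (if v == r.+1 then 0 else v));
    last by case: ifP; lia.
  apply: eq_in_count => k; rewrite mem_iota /= add0n => kr.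
  by rewrite /cyc_adjacent /cyc_succ /=; repeat case: ifP; lia.
case: (boolP (_ || _)) => [v_end|v_mid]; rewrite ?muln0 ?addn0.
  have disj: count (predI (pred1 (maxn v 1)) (pred1 r.+2)) (iota 0 r.+3) = 0.
    by rewrite (eq_count (a2 := pred0)) ?count_pred0 // => k /=; lia.
  have := count_predUI (pred1 (maxn v 1)) (pred1 r.+2) (iota 0 r.+3).
  rewrite disj addn0 !count_iota_pred1; [move=> <-|lia|lia].
  apply: eq_in_count => k; rewrite mem_iota /= add0n => kr.
  by rewrite /cyc_adjacent /cyc_succ /=; repeat case: ifP; lia.
rewrite -(@count_iota_pred1 r.+3 v.+1); last by lia.
apply: eq_in_count => k; rewrite mem_iota /= add0n => kr.
by rewrite /cyc_adjacent /cyc_succ /=; repeat case: ifP; lia.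
Qed.

Lemma count_codes r d :
  size d = r -> count (fun c => desc_word r c == d) (codes r) = (count id d).+1.
Proof.
elim: r d => [|r IHr] [|b d] //= [sz]; rewrite count_codesS.
transitivity (\sum_(c <- codes r)
  ((desc_word r c == d) + b * ((desc_word r c == d) && extreme_head r c))).
  rewrite [LHS]big_seq [RHS]big_seq /=.
  apply: eq_bigr => c /codes_cons[v [c' [-> vr]]].
  rewrite -[LHS]/(count _ (iota 0 r.+3)).
  case: eqP => [<-|neq]; last first.
    rewrite muln0 addn0 (eq_count (a2 := pred0)) ?count_pred0 // => k /=.
    by rewrite eqseq_cons; case: (_ =P d) neq => //; rewrite ?andbF.
  rewrite -[RHS]/(1 + b * ((v == 0) || (v == r.+1))).
  rewrite -(count_preceding_ranks b vr).
  apply: eq_count => k /=.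
  by rewrite eqseq_cons eqxx andbT.
have sumE (P : pred (seq nat)) : \sum_(c <- codes r) P c = count P (codes r).
  by rewrite -sum1_count [RHS]big_mkcond.
rewrite big_split /= -big_distrr /= !sumE count_codes_extreme_head // IHr //.
by rewrite muln1 addnC addnS.
Qed.

(** * Factorizations of a cycle by successive deletion *)

Section Peel.
Local Open Scope group_scope.
Variable (n : nat) (x0 : 'I_n).
Implicit Types (l : seq 'I_n) (w : seq 'S_n) (t : 'S_n).

(** The cycle given by [next l] loses its entry of index k when it is followed by
    this transposition, see [edge_next]. *)
Definition edge l k := tperm (nth x0 l k) (nth x0 l (cyc_succ (size l) k)).

Fixpoint peel l (c : seq nat) : seq 'S_n :=
  if c is k :: c' then edge l k :: peel (delete k l) c' else [::].

Lemma rlprod_cons t w x : rlprod (t :: w) x = t (rlprod w x).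
Proof. by rewrite /rlprod rev_cons big_rcons /= permM. Qed.

Lemma edge_next l k x : uniq l -> 1 < size l -> k < size l ->
  edge l k (next l x) = next (delete k l) x.
Proof.
move=> ul l1 kl; have ud := subseq_uniq (delete_subseq k l) ul.
have sl : 0 < size l by apply: ltnW.
have ck := cyc_succ_lt k sl.
have nthE i j : i < size l -> j < size l -> (nth x0 l i == nth x0 l j) = (i == j).
  by move=> *; rewrite nth_uniq.
have [/(nthP x0)[i il <-]|xl] := boolP (x \in l); last first.
  have xd : x \notin delete k l by apply: contra xl;
    apply: mem_subseq (delete_subseq k l) _.
  rewrite (next_nth l) (next_nth (delete k l)) (negPf xl) (negPf xd) tpermD //.
    by apply: contraNneq xl => <-; apply: mem_nth.
  by apply: contraNneq xl => <-; apply: mem_nth.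
rewrite (next_nth_cyc_succ x0) //.
have [->|ik] := eqVneq i k.
  by rewrite tpermR [RHS]next_nth (negPf (nth_notin_delete x0 ul kl)).
have [ik' il'] := unbump_lt il kl ik.
rewrite -{2}ik' -nth_delete // (next_nth_cyc_succ x0) ?size_delete //
  nth_delete //.
rewrite cyc_succ_bump // ik' /edge.
case: tpermP => [/eqP|/eqP|/eqP + _]; rewrite nthE ?cyc_succ_lt //.
- by move=> ->.
- by move=> /eqP/(cyc_succ_inj il kl) e; rewrite e eqxx in ik.
- by move=> /negPf->.
Qed.

Lemma is_transposition_tperm (a b : 'I_n) :
  a != b -> is_transposition (tperm a b).
Proof.
by move=> ab; apply/existsP; exists a; apply/existsP; exists b; rewrite ab eqxx.
Qed.

Lemma common_letter_tperm t (a b : 'I_n) :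
  a != b -> common_letter (tperm a b) t = (t a != a) || (t b != b).
Proof.
move=> ab; apply/existsP/orP => [[x /andP[]]|[ta|tb]].
- by case: tpermP => [->|->|]; rewrite ?eqxx //; [left|right].
- by exists a; rewrite tpermL eq_sym ab.
- by exists b; rewrite tpermR ab.
Qed.

Lemma tperm_neq (a b x : 'I_n) :
  a != b -> (tperm a b x != x) = (x == a) || (x == b).
Proof.
move=> ab; case: tpermP => [->|->|/eqP/negPf-> /eqP/negPf->];
  rewrite ?eqxx ?orbT //.
by rewrite eq_sym.
Qed.

(** The factors form a connected graph, and each of them adds at most one letter
    to the two of the last factor. *)
Lemma linear_support w :
  all (@is_transposition n) w -> sorted (@common_letter n) w ->
  exists S : {set 'I_n}, #|S| <= (w != [::]) + size w /\
    forall x, x \notin S -> all (fun t : 'S_n => t x == x) w.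
Proof.
elim: w => [|t w IHw] /=; first by exists set0; rewrite cards0.
move=> /andP[/existsP[a /existsP[b /andP[ab /eqP->]]] tw] tlw.
case: w => [|t' w] in IHw tw tlw *.
  exists [set a; b]; rewrite cards2 ab; split=> // x.
  by rewrite in_set2 andbT /= => /negPf xab; rewrite -[_ == x]negbK tperm_neq
    // xab.
move: tlw => /= /andP[ct' lw].
have [S [Sw fixS]] := IHw tw lw.
move: ct'; rewrite common_letter_tperm // => ct'.
have inS x : t' x != x -> x \in S.
  by apply: contraR => /fixS /= /andP[].
exists (a |: (b |: S)); split.
  rewrite !cardsU1 in_setU1.
  have := Sw; case/orP: ct' => /inS ->; rewrite /= ?orbT /= ?add0n => /leqW le.
    by case: (_ \notin _) => /=; rewrite ?add0n //; apply: leq_trans (ltnW le).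
  by case: (~~ _) => /=; rewrite ?add0n //; apply: leq_trans (ltnW le).
move=> x; rewrite !in_setU1 !negb_or => /and3P[xa xb /fixS /= ->].
by rewrite tpermD ?eqxx // eq_sym.
Qed.

Lemma rlprod_fix w x : all (fun t : 'S_n => t x == x) w -> rlprod w x = x.
Proof.
elim: w => [|t w IHw] /=; first by rewrite /rlprod big_nil perm1.
by move=> /andP[/eqP tx /IHw wx]; rewrite rlprod_cons wx.
Qed.

Definition cycle_words l w :=
  [/\ size w = (size l).-1, all (@is_transposition n) w,
      sorted (@common_letter n) w & rlprod w =1 next l].

Lemma edge_neq l k : uniq l -> 1 < size l -> k < size l ->
  nth x0 l k != nth x0 l (cyc_succ (size l) k).
Proof.
move=> ul l1 kl; have l0 := ltnW l1; rewrite nth_uniq ?cyc_succ_lt //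
  /cyc_succ; move: (size l) l1 kl => m.
by case: ifP; lia.
Qed.

(** The deleted letter is absent from the second edge, so a common letter must be
    its successor, which is either the second deleted letter or the successor of
    that one. *)
Lemma common_letter_edges r l k v : uniq l -> size l = r.+3 -> k < r.+3 ->
  v < r.+2 ->
  common_letter (edge l k) (edge (delete k l) v) = cyc_adjacent r k v.
Proof.
move=> ul sl kr vr.
have sd : size (delete k l) = r.+2 by rewrite size_delete sl.
have ud := subseq_uniq (delete_subseq k l) ul.
rewrite common_letter_tperm ?edge_neq ?sl //.
rewrite !tperm_neq; try by rewrite edge_neq ?sd.
have bump_lt i : i < r.+2 -> bump k i < r.+3 by rewrite bumpE; case: ifP; lia.
have cv : cyc_succ r.+2 v < r.+2 by apply: cyc_succ_lt.
have ck : cyc_succ r.+3 k < r.+3 by apply: cyc_succ_lt.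
rewrite !nth_delete ?sl // !nth_uniq ?sl ?sd ?bump_lt //.
by clear -kr vr; rewrite /cyc_adjacent /cyc_succ !bumpE; repeat case: ifP; lia.
Qed.

Lemma transposition_moved t b :
  is_transposition t -> t b != b -> t = tperm b (t b).
Proof.
case/existsP=> [x /existsP[y /andP[_ /eqP->]]].
by case: tpermP => [->|->|]; rewrite ?eqxx // tpermC.
Qed.

(** By [linear_support], w moves at most size l - 1 letters, hence fixes some b in
    l.  As t sends b to its successor, t is the edge at b, and multiplying by it
    cuts b out of the cycle. *)
Lemma cycle_word_cons l w t : uniq l -> 2 < size l ->
  cycle_words l (t :: w) ->
  exists2 k, k < size l & t = edge l k /\ cycle_words (delete k l) w.
Proof.
move=> ul l2 [/= [sw] /andP[tt tw] tlw prod_w].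
have lw := path_sorted tlw.
have [S [cS fixS]] := linear_support tw lw.
have [b bl bS] : exists2 b, b \in l & b \notin S.
  apply/subsetPn/negP => /subset_leq_card; rewrite (card_uniqP ul).
  by move: cS sw l2; case: (w) => [|? ?] /=; move: #|S| => c; lia.
have l1 := ltnW l2; have kl : index b l < size l by rewrite index_mem.
have nb : next l b = nth x0 l (cyc_succ (size l) (index b l)).
  by rewrite -(next_nth_cyc_succ x0 ul kl) nth_index.
have tb : t b = next l b.
  by rewrite -prod_w rlprod_cons (rlprod_fix (fixS _ bS)).
have tE : t = edge l (index b l).
  rewrite /edge nth_index // -nb -tb; apply: transposition_moved => //.
  by rewrite tb nb eq_sym -[X in X != _](nth_index x0 bl) edge_neq.
exists (index b l) => //; split=> //; split=> //.
  by rewrite size_delete // -sw.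
move=> x; rewrite -edge_next // -prod_w rlprod_cons.
by rewrite tE /edge tpermK.
Qed.

Lemma cycle_words_peel r l w : uniq l -> size l = r.+2 ->
  cycle_words l w <-> exists2 c, c \in codes r & w = peel l c.
Proof.
elim: r l w => [|r IHr] l w ul sl.
  case: l ul sl => [|a [|b []]] // ul _.
  split=> [[]|[c]].
    case: w => [|t []] //= _ /andP[tt _] _ prod_w.
    exists [:: 0]; first by rewrite inE.
    congr cons; rewrite /edge /=.
    have ta : t a = b by rewrite -[a](rlprod_fix (w := [::])) //
      -rlprod_cons prod_w /= eqxx.
    rewrite -ta; apply: transposition_moved => //; rewrite ta.
    by move: ul; rewrite /= inE eq_sym andbT.
  rewrite inE => /eqP-> ->; split=> //=; rewrite ?andbT.
    by apply: is_transposition_tperm; move: ul; rewrite /= inE andbT.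
  move=> x; rewrite rlprod_cons [rlprod _ x]rlprod_fix //= /edge /=.
  by case: tpermP => [->|->|/eqP/negPf-> /eqP/negPf->]; rewrite ?eqxx //;
    case: eqP.
have sd k : k < size l -> size (delete k l) = r.+2.
  by move=> kl; rewrite size_delete // sl.
have ud k := subseq_uniq (delete_subseq k l) ul.
split=> [cw|[c cr ->]].
  case: w cw => [[]|t w cw]; first by rewrite sl.
  have [k kl [tE cw']] : exists2 k, k < size l &
      t = edge l k /\ cycle_words (delete k l) w.
    by apply: cycle_word_cons; rewrite ?sl.
  have [c cr wE] := (IHr _ w (ud k) (sd k kl)).1 cw'.
  exists (k :: c); last by rewrite tE wE.
  rewrite codesS cr -sl kl /=.
  have [v [c' [cE vr]]] := codes_cons cr.
  case: cw => _ _ /=; rewrite wE tE cE /= => /andP[adj _] _.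
  by rewrite -(common_letter_edges ul sl) // -sl.
have [k [c' [cE kr]]] := codes_cons cr.
move: cr; rewrite {c}cE codesS => /and3P[cr _ adj].
have kl : k < size l by rewrite sl.
have [|sw tw lw prod_w] :=
  (IHr (delete k l) (peel (delete k l) c') (ud k) (sd k kl)).2.
  by exists c'.
have [v [c'' [cE vr]]] := codes_cons cr.
split=> /=.
- by rewrite sw sd ?sl.
- by rewrite tw andbT is_transposition_tperm ?edge_neq ?sl.
- move: lw adj; rewrite cE /= => -> adj.
  by rewrite (common_letter_edges ul sl) ?adj.
- move=> x; rewrite rlprod_cons prod_w -edge_next ?sl //.
  by rewrite /edge tpermK.
Qed.

(** Two edges of a cycle with at least three entries coincide only if they start
    at the same entry; with two entries they would also coincide for the two
    possible starting points, of which codes allow only index 0. *)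
Lemma peel_inj r l : uniq l -> size l = r.+2 ->
  {in codes r &, injective (peel l)}.
Proof.
elim: r l => [|r IHr] l ul sl c d; first by rewrite !inE => /eqP-> /eqP->.
move=> cr dr; have [k [c' [cE kr]]] := codes_cons cr;
  have [v [d' [dE vr]]] := codes_cons dr.
move: cr dr; rewrite {}cE {}dE !codesS => /and3P[cr _ _] /and3P[dr _ _]
  /= [eE pE].
have kv : k = v.
  have nthE i j : i < r.+3 -> j < r.+3 -> (nth x0 l i == nth x0 l j) = (i == j).
    by move=> *; rewrite nth_uniq ?sl.
  have := congr1 (fun t : 'S_n => t (nth x0 l k)) eE.
  have ck : cyc_succ r.+3 k < r.+3 by apply: cyc_succ_lt.
  have cv : cyc_succ r.+3 v < r.+3 by apply: cyc_succ_lt.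
  rewrite /edge tpermL sl; case: tpermP => [/eqP + _|/eqP e1 /eqP e2|_ _ /eqP].
  + by rewrite nthE // => /eqP.
  + move: e1 e2; rewrite !nthE // /cyc_succ.
    by clear -kr vr; repeat case: ifP; lia.
  + by rewrite nthE // /cyc_succ; clear; case: ifP; lia.
subst v; congr cons.
apply: (IHr (delete k l)) => //; first exact: subseq_uniq (delete_subseq k l) ul.
by rewrite size_delete ?sl.
Qed.

End Peel.

(** * Labels and descents *)

Section Labels.
Local Open Scope group_scope.
Variable (n : nat) (x0 : 'I_n).
Implicit Types (l : seq 'I_n) (w : seq 'S_n) (t : 'S_n).

(** These are the values of phi on [peel l c], by [ascent_labels]. *)
Fixpoint labels l (c : seq nat) : seq nat :=
  if c is k :: c' then
    val (nth x0 l (minn k (size l - 2))) :: labels (delete k l) c'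
  else [::].

Definition increasing l := sorted ltn (map val l).

Lemma increasing_uniq l : increasing l -> uniq l.
Proof. by move=> /(sorted_uniq ltn_trans ltnn) /map_uniq. Qed.

Lemma increasing_delete k l : increasing l -> increasing (delete k l).
Proof.
by apply: subseq_sorted ltn_trans _ _ (map_subseq _ (delete_subseq k l)).
Qed.

Lemma increasing_nth l i j : increasing l -> i < size l -> j < size l ->
  (nth x0 l i < nth x0 l j) = (i < j).
Proof.
move=> sl il jl; rewrite -!(nth_map x0 0 val) //.
have le a b : a < size l -> b < size l -> a < b ->
    nth 0 (map val l) a < nth 0 (map val l) b.
  by move=> al bl; apply: (sorted_ltn_nth ltn_trans); rewrite ?inE ?size_map.
case: (ltngtP i j) => [ij|ji|->]; [exact: le| |by rewrite ltnn].
by apply/negbTE; rewrite -leqNgt ltnW ?le.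
Qed.

(** If the deleted letter b is not the largest, then it is the letter that moves
    up: it is fixed after the deletion and goes to a larger letter before.  If b
    is the largest, then its predecessor, the second largest letter, goes up to
    b before the deletion and round to the least letter after it. *)
Lemma ascent_label r l k : increasing l -> size l = r.+2 -> k < r.+2 ->
  let a := nth x0 l (minn k r) in
  next (delete k l) a < next l a /\ a < n.-1.
Proof.
move=> il sl kr a; have ul := increasing_uniq il.
have kl : k < size l by rewrite sl.
have sd : size (delete k l) = r.+1 by rewrite size_delete // sl.
have mr : minn k r < r.+1 by rewrite ltnS geq_minr.
have aN : next l a = nth x0 l (minn k r).+1.
  by rewrite /a (next_nth_cyc_succ x0) ?sl // ?(leqW mr) // /cyc_succ ltnS mr.
split; last first.
  rewrite ltn_predRL; apply: leq_ltn_trans (ltn_ord (nth x0 l (minn k r).+1)).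
  by rewrite increasing_nth ?sl // leqW.
rewrite aN.
have [kr'|] := boolP (k <= r); last rewrite -ltnNge => rk.
  have ak : a = nth x0 l k by rewrite /a (minn_idPl kr').
  rewrite next_nth ak (negPf (nth_notin_delete x0 ul kl)) increasing_nth ?sl //.
  by rewrite (minn_idPl kr').
have -> : a = nth x0 (delete k l) r.
  by rewrite nth_delete // bumpE leqNgt rk /= /a (minn_idPr (ltnW rk)).
rewrite (next_nth_cyc_succ x0) ?sd //;
  last exact: subseq_uniq (delete_subseq k l) ul.
rewrite nth_delete // /cyc_succ ltnn increasing_nth ?sl // bumpE;
  case: ifP => //; lia.
Qed.

Lemma rlprod_peel r l c : uniq l -> size l = r.+2 -> c \in codes r ->
  rlprod (peel x0 l c) =1 next l.
Proof.
move=> ul sl cr; have [|//] := (cycle_words_peel x0 (peel x0 l c) ul sl).2.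
by exists c.
Qed.

Lemma ascent_labels r l c j : increasing l -> size l = r.+2 -> c \in codes r ->
  j < r.+1 -> exists a : 'I_n, [/\ val a = nth 0 (labels l c) j, a < n.-1 &
    rlprod (drop j.+1 (peel x0 l c)) a < rlprod (drop j (peel x0 l c)) a].
Proof.
elim: r l c j => [|r IHr] l c j il sl cr jr.
all: have ul := increasing_uniq il; have prod_l := rlprod_peel ul sl cr.
all: have [k [c' [cE kr]]] := codes_cons cr.
all: have [lt_a a_n] := ascent_label il sl kr.
all: have sd : size (delete k l) = (size l).-1 by rewrite size_delete ?sl.
all: rewrite sl /= in sd.
  move: cr; rewrite {}cE inE in prod_l * => /eqP[k0 c0].
  case: j jr => // _; exists (nth x0 l (minn k 0)).
  rewrite drop0 prod_l /= c0 sl subnn drop0 /=; split=> //.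
  rewrite [rlprod _ _]rlprod_fix //; move: lt_a.
  by case: (delete k l) sd => [|y []] //= _; case: eqP => [->|].
case: j jr => [_|j jr]; last first.
  move: cr; rewrite cE codesS => /and3P[cr _ _].
  have [a [aE an lta]] := IHr (delete k l) c' j (increasing_delete k il) sd cr jr.
  by exists a.
exists (nth x0 l (minn k r.+1)); rewrite drop0 prod_l.
move: cr; rewrite cE codesS => /and3P[cr _ _] /=.
rewrite sl !subSS subn0 drop0; split=> //.
by rewrite (rlprod_peel _ sd cr) // increasing_uniq ?increasing_delete.
Qed.

(** Deletion shifts only indices at or above that of the current label: comparing
    the next index, in the shortened list, with it amounts to comparing letters. *)
Lemma desc_word_labels r l c i : increasing l -> size l = r.+2 -> c \in codes r ->
  i < r ->
  nth false (desc_word r c) i = (nth 0 (labels l c) i.+1 < nth 0 (labels l c) i).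
Proof.
elim: r l c i => [//|r IHr] l c i il sl cr ir.
have [k [c' [cE kr]]] := codes_cons cr.
have kl : k < size l by rewrite sl.
have sd : size (delete k l) = r.+2 by rewrite size_delete ?sl.
move: cr; rewrite {}cE codesS => /and3P[cr _ _].
case: i ir => [_|i ir]; last by apply: IHr; rewrite ?increasing_delete.
have [v [c'' [-> vr]]] := codes_cons cr.
rewrite /= sd sl !subSS !subn0 nth_delete // increasing_nth ?sl //.
- by rewrite bumpE; clear -kr vr; case: ifP; lia.
- by rewrite bumpE; clear -kr vr; case: ifP; lia.
- by clear -kr; lia.
Qed.

End Labels.

Lemma increasing_enum n : increasing (enum 'I_n).
Proof. by rewrite /increasing val_enum_ord iota_ltn_sorted. Qed.

Lemma long_cycle_next r : long_cycle r.+1 =1 next (enum 'I_r.+1).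
Proof.
move=> x; rewrite permE -{2}(nth_ord_enum ord0 x) (next_nth_cyc_succ ord0);
  last 2 first.
- exact: enum_uniq.
- by rewrite size_enum_ord.
rewrite size_enum_ord /cyc_succ; apply: val_inj => /=.
case: ifP => [xr|xr]; first by rewrite nth_enum_ord // modn_small.
have xE : x = r :> nat by have := ltn_ord x; lia.
by rewrite nth_enum_ord // xE modnn.
Qed.

Section Reindex.
Variable r : nat.
Let l := enum 'I_r.+2.
Let peel_l := peel ord0 l.

Lemma linearly_ordered_peel (w : r.+2.-1.-tuple 'S_r.+2) :
  w \in linearly_ordered r.+2 <-> exists2 c, c \in codes r & tval w = peel_l c.
Proof.
rewrite -(cycle_words_peel _ _ (enum_uniq _) (size_enum_ord _)) !inE.
split=> [/andP[/andP[tw /eqP prod_w] lw]|[_ tw lw prod_w]].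
  split=> //; first by rewrite size_tuple size_enum_ord.
  by move=> x; rewrite prod_w long_cycle_next.
rewrite tw lw andbT; apply/eqP/permP => x; rewrite prod_w.
by rewrite long_cycle_next.
Qed.

Lemma val_phi_peel (w : r.+2.-1.-tuple 'S_r.+2) c (j : 'I_r.+2.-1) :
  c \in codes r -> tval w = peel_l c -> val (phi w j) = nth 0 (labels ord0 l c) j.
Proof.
move=> cr wE; have wU : w \in linearly_ordered r.+2
  by apply/linearly_ordered_peel; exists c.
have wF : w \in factorizations r.+2 by case/setIdP: wU.
have [a [aE an lta]] := ascent_labels ord0 (increasing_enum _)
  (size_enum_ord _) cr (ltn_ord j).
rewrite -aE; have /setP/(_ (Ordinal an)) := phiP wF j.
rewrite !inE /sigma /= wE.
have -> : widen_ord (leq_pred r.+2) (Ordinal an) = a by apply: val_inj.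
by rewrite lta => /esym/eqP <-.
Qed.

Definition set_word (D : {set 'I_r}) : seq bool := [seq i \in D | i <- enum 'I_r].

Lemma Des_phi_peel (w : r.+2.-1.-tuple 'S_r.+2) c (D : {set 'I_r}) :
  c \in codes r -> tval w = peel_l c ->
  (Des (phi w) == D) = (desc_word r c == set_word D).
Proof.
move=> cr wE.
have DesE (i : 'I_r) : (i \in Des (phi w)) = nth false (desc_word r c) i.
  rewrite inE (desc_word_labels ord0 (increasing_enum r.+2)) ?size_enum_ord //.
  by rewrite !(val_phi_peel _ cr wE).
have sdw : size (desc_word r c) = r.
  elim: (r) (c) cr => [|r' IHr] c' c'r; have [k [c'' [cE _]]] := codes_cons c'r.
    by rewrite cE.
  by move: c'r; rewrite cE codesS => /and3P[/IHr /= -> _ _].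
apply/eqP/eqP => [<-|dE].
  apply: (@eq_from_nth _ false); first by rewrite size_map size_enum_ord.
  move=> i; rewrite sdw => ir; rewrite (nth_map (Ordinal ir)) ?size_enum_ord //.
  by rewrite -[i]/(val (Ordinal ir)) nth_ord_enum DesE.
apply/setP => i; rewrite DesE dE (nth_map i) ?size_enum_ord //.
by rewrite nth_ord_enum.
Qed.

(** The codes whose descent word is the indicator of D are counted by
    [count_codes], and [peel] is a bijection from codes to factorizations. *)
Lemma card_linearly_ordered_Des (D : {set 'I_r}) :
  #|[set w in linearly_ordered r.+2 | Des (phi w) == D]| = #|D|.+1.
Proof.
have sD : size (set_word D) = r by rewrite size_map size_enum_ord.
have -> : #|D| = count id (set_word D).
  by rewrite cardE /set_word count_map -size_filter enumT /enum_mem.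
rewrite -(count_codes sD) -size_filter cardE -(size_map peel_l) -(size_map val).
apply: perm_size; apply: uniq_perm.
- by rewrite map_inj_uniq ?enum_uniq //; apply: val_inj.
- rewrite map_inj_in_uniq ?filter_uniq ?codes_uniq //.
  move=> c d; rewrite !mem_filter => /andP[_ cr] /andP[_ dr].
  by apply: peel_inj cr dr; [apply: enum_uniq | rewrite size_enum_ord].
move=> s; apply/mapP/mapP => [[w]|[c]].
  rewrite mem_enum => /setIdP[/linearly_ordered_peel[c cr wE] wD ->].
  by exists c => //; rewrite mem_filter cr andbT -(Des_phi_peel _ cr wE).
rewrite mem_filter => /andP[cD cr] ->.
have [sp _ _ _] := (cycle_words_peel ord0 (peel_l c) (enum_uniq _)
  (size_enum_ord _)).2 (ex_intro2 _ _ c cr erefl).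
have sz : size (peel_l c) == r.+1 by rewrite sp size_enum_ord.
exists (Tuple sz) => //; rewrite mem_enum; apply/setIdP; split.
  by apply/linearly_ordered_peel; exists c.
by rewrite (Des_phi_peel _ cr).
Qed.
End Reindex.

(** * Hook Schur functions *)

Definition strict_steps m (y : seq nat) : {set 'I_m.-1} :=
  [set i : 'I_m.-1 | nth 0 y i < nth 0 y i.+1].

(** The only weakly increasing rearrangement of M is its sorted word. *)
Lemma fundamental_sort m (D : {set 'I_m.-1}) (M : {mset nat}%mset) :
  fundamental D M =
  Posz ((size M == m) && (D \subset strict_steps m (sort leq M))).
Proof.
rewrite /fundamental /word_series; congr Posz.
set y := sort leq M; set P := fun w : seq nat => _.
have Py : P y = (size M == m) && (D \subset strict_steps m y).
  rewrite /P size_sort sort_sorted; last exact: leq_total.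
  congr andb; apply/'forall_implyP/subsetP => sub i.
    by move=> /sub; rewrite inE.
  by move=> /sub; rewrite inE.
rewrite -Py (eq_in_count (a2 := fun w => P y && (w == y))); last first.
  move=> w; rewrite mem_permutations => wM; apply/idP/andP => [Pw|[Py' /eqP->//]].
  have wy : w = y.
    apply: (sorted_eq leq_trans anti_leq); first by case/and3P: Pw.
      exact: sort_sorted leq_total _.
    by rewrite (perm_trans wM) // perm_sym perm_sort.
  by rewrite -wy eqxx.
case: (P y); last by rewrite /= count_pred0.
rewrite (@eq_count _ _ (pred1 y)) // count_uniq_mem ?permutations_uniq //.
by rewrite mem_permutations perm_sort perm_refl.
Qed.

Lemma sum_strict_steps y : sorted leq y ->
  \sum_(i < (size y).-1) (nth 0 y i < nth 0 y i.+1) = (size (undup y)).-1.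
Proof.
elim: y => [|a [|b y] IHy]; [by rewrite big_ord0 | by rewrite big_ord0 |].
move=> srt; rewrite big_ord_recl.
rewrite (eq_bigr (fun i : 'I_(size (b :: y)).-1 =>
  (nth 0 (b :: y) i < nth 0 (b :: y) i.+1) : nat)); last by [].
rewrite IHy; last by case/andP: srt.
have -> : undup [:: a, b & y] =
  if a \in b :: y then undup (b :: y) else a :: undup (b :: y) by [].
(* In a sorted word, a is strictly below the next letter exactly when it does
   not occur again. *)
have ab : nth 0 [:: a, b & y] (ord0 : 'I_(size y).+1)
    < nth 0 [:: a, b & y] (ord0 : 'I_(size y).+1).+1 = (a \notin b :: y).
  rewrite [LHS]/=; case/andP: srt => ab /(order_path_min leq_trans)/allP by_.
  rewrite inE; case: ltngtP ab => //= ab _.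
  by apply/esym/negP => /by_; rewrite leqNgt ab.
rewrite ab; case: (a \in b :: y) => //=.
have : b \in undup (b :: y) by rewrite mem_undup mem_head.
by rewrite -/(undup (b :: y)); case: (undup (b :: y)).
Qed.

Lemma card_strict_steps m (s : seq nat) : size s = m ->
  #|strict_steps m (sort leq s)| = (size (undup s)).-1.
Proof.
move=> sm; have := sum_strict_steps (sort_sorted leq_total s).
have -> : size (undup (sort leq s)) = size (undup s).
  by apply/perm_size/perm_undup => x; rewrite mem_sort.
move=> <-; rewrite size_sort sm -sum1_card [LHS]big_mkcond /=.
by apply: eq_bigr => i _; rewrite inE; case: ltnP.
Qed.

Lemma sum_fundamental m k (M : {mset nat}%mset) :
  (\sum_(D : {set 'I_m.-1} | #|D| == k) fundamental D M)%R =
  Posz ((size M == m) * 'C((size (undup M)).-1, k)).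
Proof.
under eq_bigr do rewrite fundamental_sort.
case: eqP => sM; last by rewrite big1.
rewrite mul1n -(card_strict_steps sM) -cards_draws.
rewrite -sum1_card (big_morph Posz PoszD (erefl _)).
rewrite [RHS]big_mkcond [LHS]big_mkcond.
by apply: eq_bigr => D _; rewrite inE andbC; case: eqP; case: (_ \subset _).
Qed.

(** The reading word, row first, of a tableau of shape (m - k, 1^k): the corner of
    the hook starts both the row and, followed by the rest of the word, the
    column. *)
Definition hook_word m k (w : seq nat) :=
  [&& size w == m, sorted leq (take (m - k) w)
    & path ltn (head 0 w) (drop (m - k) w)].

Lemma sorted_reshape_nseq1 k (s : seq nat) :
  size s = k -> reshape (nseq k 1) s = [seq [:: x] | x <- s].
Proof. by elim: k s => [|k IHk] [|x s] //= [sk]; rewrite drop0 IHk ?take0. Qed.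

Lemma semistandard_hook m k w : k < m ->
  (size w == sumn (hook (m - k) k)) && semistandard (reshape (hook (m - k) k) w)
  = hook_word m k w.
Proof.
move=> km; rewrite /hook_word /= sumn_nseq mul1n subnK; last exact: ltnW.
case: eqP => //= sw.
have sd : size (drop (m - k) w) = k by rewrite size_drop; lia.
rewrite sorted_reshape_nseq1 // /semistandard /=.
have -> : all (sorted leq) [seq [:: x] | x <- drop (m - k) w]
  by apply/allP => _ /mapP[x _ ->].
rewrite andbT; congr andb.
have -> : path ltn (head 0 w) = path ltn (head 0 (take (m - k) w)).
  have mk : 0 < m - k by rewrite subn_gt0.
  by case: (w) (m - k) mk => [|x w'] [|j].
set row := take _ w; set col := drop _ w.
have nthT i : i < size col ->
  nth [::] [seq [:: x] | x <- col] i = [:: nth 0 col i].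
  by move=> ic; rewrite (nth_map 0).
have headT i : i <= size col ->
  nth 0 (nth [::] (row :: [seq [:: x] | x <- col]) i) 0
  = nth 0 (head 0 row :: col) i.
  by case: i => [|i] ic; rewrite /= ?nth0 ?nthT.
apply/forallP/(pathP 0) => [H i ic|H i].
  have ic' : i < (size [seq [:: x] | x <- col]).+1 by rewrite size_map ltnW.
  have /forallP := H (Ordinal ic'); rewrite [nat_of_ord _]/=.
  have sz1 : 0 < size (nth [::] [seq [:: x] | x <- col] i) by rewrite nthT.
  by move=> /(_ (Ordinal sz1)); rewrite [nat_of_ord (Ordinal sz1)]/= headT
    ?(ltnW ic) // nthT.
apply/forallP => -[j jP]; rewrite [nat_of_ord (Ordinal jP)]/=.
case: (ltnP i (size col)) => ic.
  move: jP; rewrite nthT // ltnS leqn0 => /eqP->.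
  by rewrite headT ?(ltnW ic) //; apply: H.
by have := jP; rewrite [X in size X]nth_default //;
  apply: leq_trans (eq_leq (size_map _ _)) ic.
Qed.

Lemma uniq_complement (c s : seq nat) :
  uniq c -> {subset c <= s} -> exists rest, perm_eq (rest ++ c) s.
Proof.
move=> uc cs; have [s' s's cs'] := (count_subseqP _ _).1 (leq_uniq_count uc cs).
have [rest sE] := perm_to_subseq s's; exists rest.
by rewrite perm_catC perm_sym (perm_trans sE) // perm_cat2r perm_sym.
Qed.

Section HookTableaux.
Variables (m k : nat) (s : seq nat).
Hypotheses (km : k < m) (sm : size s = m).
Let larger := behead (undup (sort leq s)).
Let d := (size (undup s)).-1.

Lemma undup_sort_sorted : sorted ltn (undup (sort leq s)).
Proof. by rewrite ltn_sorted_uniq_leq undup_uniq undup_sorted ?sort_sorted //;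
  [exact: leq_trans | exact: leq_total]. Qed.

Lemma size_larger : size larger = d.
Proof. by rewrite size_behead; congr predn; apply/perm_size/perm_undup => x;
  rewrite mem_sort. Qed.

Lemma uniq_larger : uniq larger.
Proof. by apply: subseq_uniq (undup_uniq (sort leq s));
  rewrite /larger -drop1 drop_subseq. Qed.

Lemma sorted_larger : sorted ltn larger.
Proof. by apply: subseq_sorted undup_sort_sorted;
  [exact: ltn_trans | rewrite /larger -drop1 drop_subseq]. Qed.

(** As [larger] omits the least letter of s, membership means that some letter of
    s is strictly smaller. *)
Lemma mem_larger x : (x \in larger) = (x \in s) && has (ltn^~ x) s.
Proof.
have [y [u ysE]] : exists y u, undup (sort leq s) = y :: u.
  have : size (undup s) != 0 by rewrite size_eq0; apply/eqP => /undup_nil;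
    move: sm km => <- /[swap] ->.
  have -> : size (undup s) = size (undup (sort leq s)).
    by apply/perm_size/perm_undup => z; rewrite mem_sort.
  by case: (undup (sort leq s)) => // y u _; exists y, u.
have ms z : (z \in s) = (z \in y :: u) by rewrite -ysE mem_undup mem_sort.
have := undup_sort_sorted; rewrite /larger ysE /= =>
  /(order_path_min ltn_trans)/allP yu.
rewrite ms inE; case: eqP => [->|xy] /=.
  rewrite (negPf (_ : y \notin u)); last by apply/negP => /yu /=; rewrite ltnn.
  apply/esym/hasPn => z; rewrite ms inE => /orP[/eqP->|/yu /= /ltnW];
    by rewrite -leqNgt.
case: (boolP (x \in u)) => //= xu; apply/esym/hasP; exists y; last exact: yu.
by rewrite ms mem_head.
Qed.

(** The column below the corner is strictly increasing and avoids the least letter,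
    which sits in the corner; it is recorded as a set of indices in [larger]. *)
Definition column_set (w : seq nat) : {set 'I_d} :=
  [set i : 'I_d | nth 0 larger i \in drop (m - k) w].

Lemma hook_word_column w : hook_word m k w -> perm_eq w s ->
  sorted ltn (drop (m - k) w) /\ {subset drop (m - k) w <= larger}.
Proof.
move=> /and3P[_ _ pw] ws; split; first exact: path_sorted pw.
move=> x xw; rewrite mem_larger -(perm_mem ws) (mem_drop xw) /=.
apply/hasP; exists (head 0 w); last first.
  by have /allP := order_path_min ltn_trans pw; apply.
rewrite -(perm_mem ws); case: (w) xw => [|y w']; last by rewrite /= mem_head.
by rewrite drop_oversize.
Qed.

(** The set determines the sorted column, hence the multiset of the row, hence the
    sorted row. *)
Lemma column_set_inj w1 w2 :
  hook_word m k w1 -> perm_eq w1 s -> hook_word m k w2 -> perm_eq w2 s ->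
  column_set w1 = column_set w2 -> w1 = w2.
Proof.
move=> h1 p1 h2 p2 c12.
have [s1 v1] := hook_word_column h1 p1; have [s2 v2] := hook_word_column h2 p2.
have colE : drop (m - k) w1 = drop (m - k) w2.
  apply: (irr_sorted_eq ltn_trans ltnn s1 s2) => x.
  have [xv|xv] := boolP (x \in larger); last first.
    by rewrite (contraNF (v1 x)) // (contraNF (v2 x)).
  have xd : index x larger < d by rewrite -size_larger index_mem.
  by have /setP/(_ (Ordinal xd)) := c12; rewrite !inE /= nth_index.
rewrite -(cat_take_drop (m - k) w1) -(cat_take_drop (m - k) w2) colE; congr cat.
apply: (sorted_eq leq_trans anti_leq); [by case/and3P: h1 | by case/and3P: h2 |].
rewrite -(perm_cat2r (drop (m - k) w1)) {2}colE !cat_take_drop.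
by rewrite (perm_trans p1) // perm_sym.
Qed.

Lemma card_column_set w : hook_word m k w -> perm_eq w s -> #|column_set w| = k.
Proof.
move=> h p; have [sw vw] := hook_word_column h p.
have sd : size (drop (m - k) w) = k.
  by rewrite size_drop (perm_size p) sm subKn // ltnW.
rewrite -[RHS]sd cardE -(size_map (fun i : 'I_d => nth 0 larger i)).
apply/perm_size/uniq_perm; last move=> x.
- rewrite map_inj_uniq ?enum_uniq // => i j /eqP.
  by rewrite nth_uniq ?size_larger ?uniq_larger // => /eqP/val_inj.
- exact: sorted_uniq ltn_trans ltnn _ sw.
apply/mapP/idP => [[i]|xw]; first by rewrite mem_enum inE => iw ->.
have xd : index x larger < d by rewrite -size_larger index_mem vw.
have xE : nth 0 larger (Ordinal xd) = x by rewrite /= nth_index ?vw.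
by exists (Ordinal xd) => //; rewrite mem_enum inE xE.
Qed.

(** The row is the sorted complement of the prescribed column in s.  It contains
    the least letter z of s, so its first entry is smaller than the column. *)
Lemma column_set_onto (A : {set 'I_d}) : #|A| = k ->
  exists w, [/\ hook_word m k w, perm_eq w s & column_set w = A].
Proof.
move=> Ak; pose col := [seq nth 0 larger (nat_of_ord i) | i <- enum A].
have vinj : injective (fun i : 'I_d => nth 0 larger i).
  by move=> i j /eqP; rewrite nth_uniq ?size_larger ?uniq_larger // =>
    /eqP/val_inj.
have sc : size col = k by rewrite size_map -cardE.
have srt : sorted ltn col.
  rewrite sorted_map; apply: (@sub_sorted _ (relpre val ltn)).
    move=> i j; apply: (sorted_ltn_nth ltn_trans 0 sorted_larger).
      by rewrite inE size_larger; apply: ltn_ord.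
    by rewrite inE size_larger; apply: ltn_ord.
  rewrite /enum_mem; apply: sorted_filter; first by move=> ? ? ?;
    apply: ltn_trans.
  by rewrite -sorted_map -enumT val_enum_ord iota_ltn_sorted.
have ucol : uniq col := sorted_uniq ltn_trans ltnn srt.
have cv : {subset col <= larger}.
  by move=> x /mapP[i _ ->]; rewrite mem_nth ?size_larger.
have [|rest restP] := @uniq_complement col s ucol.
  by move=> x /cv; rewrite mem_larger => /andP[].
have sr : size rest = m - k.
  by have := perm_size restP; rewrite size_cat sc sm => <-; rewrite addnK.
pose row := sort leq rest.
have srow : size row = m - k by rewrite size_sort.
have wP : perm_eq (row ++ col) s.
  by apply: perm_trans restP; rewrite perm_cat2r perm_sort.
exists (row ++ col); split=> //; last first.
  apply/setP => i; rewrite inE drop_size_cat //.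
  by rewrite (mem_map vinj) mem_enum.
rewrite /hook_word (perm_size wP) sm eqxx take_size_cat // drop_size_cat //.
rewrite sort_sorted /=; last exact: leq_total.
rewrite path_min_sorted //; apply/allP => x xc.
have /hasP[y ys yx] : has (ltn^~ x) s by have := cv _ xc;
  rewrite mem_larger => /andP[].
(* No letter of s is below z, so z is not a letter of the column and must be in the
   row. *)
pose z := head 0 (sort leq s).
have zmin u : u \in s -> z <= u.
  rewrite /z -(mem_sort leq); have := sort_sorted leq_total s.
  case: (sort leq s) => //= a l /(order_path_min leq_trans)/allP al.
  by rewrite inE => /orP[/eqP->|/al].
have zs : z \in s.
  rewrite /z -(mem_sort leq); have := size_sort leq s; rewrite sm.
  by case: (sort leq s) => [/= m0|a l _]; [move: km;
    rewrite -m0 | rewrite mem_head].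
have zrow : z \in row.
  have := zs; rewrite -(perm_mem wP) mem_cat => /orP[//|/cv].
  by rewrite mem_larger => /andP[_ /hasP[u /zmin zu /=]]; rewrite ltnNge zu.
have head_z : head 0 (row ++ col) <= z.
  have := sort_sorted leq_total rest; move: zrow; rewrite -/row.
  case: (row) => //= a l; rewrite inE => /orP[/eqP->//|zl].
  by move=> /(order_path_min leq_trans)/allP/(_ _ zl).
exact: leq_ltn_trans (leq_trans head_z (zmin _ ys)) yx.
Qed.

Lemma count_hook_word : count (hook_word m k) (permutations s) = 'C(d, k).
Proof.
rewrite -[in RHS](card_ord d) -card_draws -size_filter cardE -(size_map column_set).
apply/perm_size/uniq_perm; last move=> A.
- rewrite map_inj_in_uniq ?filter_uniq ?permutations_uniq // => w1 w2.
  rewrite !mem_filter !mem_permutations => /andP[h1 p1] /andP[h2 p2].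
  exact: column_set_inj.
- exact: enum_uniq.
rewrite mem_enum inE; apply/mapP/eqP => [[w]|/column_set_onto[w [h p <-]]].
  by rewrite mem_filter mem_permutations => /andP[h p] ->; apply: card_column_set.
by exists w; rewrite // mem_filter mem_permutations h.
Qed.

End HookTableaux.

(** The column below the corner is an arbitrary k-element subset of the distinct
    letters other than the least, and the row is the rest. *)
Lemma schur_hook m k (M : {mset nat}%mset) : k < m ->
  schur (hook (m - k) k) M =
  Posz ((size M == m) * 'C((size (undup M)).-1, k)).
Proof.
move=> km; rewrite /schur /word_series (eq_count (a2 := hook_word m k));
  last first.
  by move=> w; apply: semistandard_hook.
congr Posz; case: eqP => sM; first by rewrite mul1n count_hook_word.
rewrite (eq_in_count (a2 := pred0)) ?count_pred0 // => w.
by rewrite mem_permutations => /perm_size wM; rewrite /hook_word wM; case: eqP.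
Qed.

(** Each side is the binomial coefficient of (number of distinct letters) - 1
    and k. *)
Lemma schur_hook_fundamental m k (M : {mset nat}%mset) : k < m ->
  schur (hook (m - k) k) M =
  (\sum_(D : {set 'I_m.-1} | #|D| == k) fundamental D M)%R.
Proof. by move=> km; rewrite sum_fundamental schur_hook. Qed.

Lemma schur_hook_rename m k (g : nat -> nat) (M : {mset nat}%mset) :
  k < m -> injective g ->
  schur (hook (m - k) k) (seq_mset (map g M)) = schur (hook (m - k) k) M.
Proof.
move=> km g_inj; have gM := perm_eq_seq_mset (map g M).
rewrite !schur_hook // (perm_size gM) size_map.
suff -> : size (undup (seq_mset (map g M))) = size (undup M) by [].
rewrite -[RHS](size_map g) -undup_map_inj //.
exact/perm_size/perm_undup/perm_mem.
Qed.

(** * Schur positivity *)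

Theorem theorem1p4 (n : nat) (hn : 2 <= n) :
  (forall M : {mset nat}%mset,
     Qsym (linearly_ordered n) M =
     (\sum_(k < n.-1) (k.+1)%:R * schur (hook (n.-1 - k) k) M)%R) /\
  schur_positive (Qsym (linearly_ordered n)).
Proof.
case: n hn => [|[|r]] // _.
have QE (M : {mset nat}%mset) : Qsym (linearly_ordered r.+2) M =
     (\sum_(k < r.+1) (k.+1)%:R * schur (hook (r.+1 - k) k) M)%R.
  rewrite /Qsym (partition_big (fun w => Des (phi w)) predT) //=.
  transitivity (\sum_(D : {set 'I_r})
    (#|D|.+1)%:R * fundamental (D : {set 'I_r.+1.-1}) M)%R.
    apply: eq_bigr => D _.
    rewrite (eq_bigr (fun=> fundamental (D : {set 'I_r.+1.-1}) M));
      last by move=> w /andP[_ /eqP->].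
    rewrite GRing.sumr_const -[LHS]GRing.mulr_natl -(card_linearly_ordered_Des D).
    by rewrite cardsE.
  have card_lt (D : {set 'I_r}) : #|D| < r.+1.
    by rewrite ltnS -[X in _ <= X]card_ord max_card.
  rewrite (partition_big (fun D : {set 'I_r} => Ordinal (card_lt D)) predT) //=.
  apply: eq_bigr => k _; rewrite (schur_hook_fundamental _ (ltn_ord k)).
  rewrite GRing.mulr_sumr.
  by apply: eq_big => [D|D /eqP<-].
split=> //; split; first split.
- exists r.+1 => M; rewrite QE; apply: contraNT; rewrite -ltnNge => rM.
  rewrite big1 // => k _; rewrite schur_hook //.
  by rewrite gtn_eqF // mul0n GRing.mulr0.
- move=> g /bij_inj g_inj M; rewrite !QE; apply: eq_bigr => k _.
  by rewrite schur_hook_rename.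
(* The hook (r + 1 - k, 1^k) has k + 1 rows, so its coefficient is its length. *)
exists [seq hook (r.+1 - k) k | k <- index_iota 0 r.+1],
  (fun lam => (size lam)%:R%R).
split.
- rewrite map_inj_uniq ?iota_uniq // => j k [_ ] /(congr1 size).
  by rewrite !size_nseq.
- apply/allP => lam /mapP[k]; rewrite mem_index_iota => kr ->.
  have rk : 0 < r.+1 - k by rewrite subn_gt0.
  rewrite /is_partition /hook /= inE negb_or mem_nseq andbF
    /= andbT eq_sym -lt0n rk andbT.
  by case: k rk {kr} => //= k rk; rewrite rk /=; elim: k {rk} => //= k IHk.
- by move=> lam _; apply: Num.Theory.ler0n.
move=> M; rewrite QE big_map big_mkord.
by apply: eq_bigr => k _; rewrite /= size_nseq.
Qed.
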